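(* Let $\mathcal{F}$ be a set of fields that contains at least one infinite field, and let $M(\mathcal{F})$ denote the class of (finite) matroids that are representable over at least one field in $\mathcal{F}$. There does not exist a finite set $\mathcal{K}$ of sentences in $M$-logic with the following property: for every structure $(E,r)$ (with $E$ a finite set and $r\colon\mathcal{P}(E)\to\mathbb{Z}_{\ge 0}$), $(E,r)$ is a matroid in $M(\mathcal{F})$ if and only if $(E,r)$ satisfies the rank axioms $\mathbf{R1},\mathbf{R2},\mathbf{R3}$ and every sentence in $\mathcal{K}$.
   Context: A structure is a pair $(E,r)$ where $E$ is a finite set and $r$ is a function from the power set $\mathcal{P}(E)$ to the non-negative integers. A matroid is a structure whose function $r$ is a rank function; a matroid is representable over a field $F$ if there is a map $\phi$ from $E$ to an $F$-vector space with $r(S)=\dim\langle\phi(s):s\in S\rangle$ for all $S\subseteq E$. Monadic second-order logic for matroids (MSOL): there are element variables $x_1,x_2,\dots$ and set variables $X_1,X_2,\dots$. Set terms are built from the constants $E$, $\emptyset$, set variables $X_i$, singletons $\{x_i\}$ of element variables, and closed under complement $\overline{X}$, union $X\cup Y$ and intersection $X\cap Y$. Integer terms are built from the constants $0,1,2,\dots$, the terms $|X|$ and $r(X)$ for set terms $X$, and closed under $+$. Atomic formulas are $x=y$ (element variables), $X=Y$ and $X\subseteq Y$ (set terms), $p=q$ and $p\le q$ (integer terms), and $x\in X$. Formulas are built from atomic formulas using $\neg,\lor,\land$ and quantifiers $\exists,\forall$ over element variables and over set variables; a sentence is a formula with no free variables. In a structure $(E,r)$, element variables range over elements of $E$, set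 variables over subsets of $E$, $E,\emptyset,\overline{\cdot},\cup,\cap,\{\cdot\}$ have their set-theoretic meaning relative to $E$, $|X|$ is cardinality, $r(X)$ is the value of the given function $r$, and $+,=,\le,\in,\subseteq$ have their usual meaning; this defines when a structure satisfies a sentence. $M$-logic is the set of MSOL formulas that are equivalent (satisfied by exactly the same structures and assignments of free variables) to a formula of the form $Q_{1}X_{i_1}\cdots Q_{m}X_{i_m}\,Q'_{1}x_{j_1}\cdots Q'_{n}x_{j_n}\,P$, where $P$ is quantifier-free, $X_{i_k}$ are set variables, $x_{j_k}$ are element variables, all of $Q_1,\dots,Q_m$ are the same quantifier (all $\exists$ or all $\forall$), and all of $Q'_1,\dots,Q'_n$ are the same quantifier (all $\exists$ or all $\forall$). The rank axioms are the sentences $\mathbf{R1}$: $\forall X_1\ r(X_1)\le |X_1|$; $\mathbf{R2}$: $\forall X_1\forall X_2\ X_1\subseteq X_2\to r(X_1)\le r(X_2)$; $\mathbf{R3}$: $\forall X_1\forall X_2\ r(X_1\cup X_2)+r(X_1\cap X_2)\le r(X_1)+r(X_2)$. *)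

(* Defs.v *)
From HB Require Import structures.
From mathcomp Require Import all_boot all_order all_algebra.
From mathcomp Require classical_sets cardinality.
From Stdlib Require List.

Set Implicit Arguments.
Unset Strict Implicit.
Unset Printing Implicit Defensive.

Record structure := Structure {
  ground : finType;
  rk : {set ground} -> nat
}.

Definition is_matroid (M : structure) : Prop :=
  [/\ forall X : {set ground M}, rk X <= #|X|,
      forall X Y : {set ground M}, X \subset Y -> rk X <= rk Y
    & forall X Y : {set ground M}, rk (X :|: Y) + rk (X :&: Y) <= rk X + rk Y].

(* Since the ground set is finite, the vectors phi s always lie in a finite
   dimensional space, so ranging over vectType loses no generality. *)
Definition representable (F : fieldType) (M : structure) : Prop :=
  exists (V : vectType F) (phi : ground M -> V),
    forall S : {set ground M}, rk S = \dim <<[seq phi s | s in S]>>.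

Definition representable_over_some (Fs : fieldType -> Prop) (M : structure) :
    Prop :=
  exists2 F : fieldType, Fs F & representable F M.

Definition infinite_field (F : fieldType) : Prop :=
  cardinality.infinite_set (@classical_sets.setT F).

(* Element variables and set variables are two disjoint families, each indexed
   by nat. *)

Inductive set_term :=
  | SFull
  | SEmpty
  | SVar of nat
  | SSingle of nat
  | SCompl of set_term
  | SUnion of set_term & set_term
  | SInter of set_term & set_term.

Inductive int_term :=
  | IConst of nat
  | ICard of set_term
  | IRank of set_term
  | IAdd of int_term & int_term.

Inductive formula :=
  | FEltEq of nat & nat
  | FSetEq of set_term & set_term
  | FSubset of set_term & set_term
  | FIntEq of int_term & int_term
  | FLe of int_term & int_term
  | FIn of nat & set_term
  | FNot of formula
  | FOr of formula & formula
  | FAnd of formula & formula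
  | FExElt of nat & formula
  | FAllElt of nat & formula
  | FExSet of nat & formula
  | FAllSet of nat & formula.

Definition FImp (f g : formula) : formula := FOr (FNot f) g.

Fixpoint set_term_elts (t : set_term) : seq nat :=
  match t with
  | SFull | SEmpty | SVar _ => [::]
  | SSingle i => [:: i]
  | SCompl t1 => set_term_elts t1
  | SUnion t1 t2 | SInter t1 t2 => set_term_elts t1 ++ set_term_elts t2
  end.

Fixpoint set_term_sets (t : set_term) : seq nat :=
  match t with
  | SFull | SEmpty | SSingle _ => [::]
  | SVar i => [:: i]
  | SCompl t1 => set_term_sets t1
  | SUnion t1 t2 | SInter t1 t2 => set_term_sets t1 ++ set_term_sets t2
  end.

Fixpoint int_term_elts (p : int_term) : seq nat :=
  match p with
  | IConst _ => [::]
  | ICard t | IRank t => set_term_elts t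
  | IAdd p1 p2 => int_term_elts p1 ++ int_term_elts p2
  end.

Fixpoint int_term_sets (p : int_term) : seq nat :=
  match p with
  | IConst _ => [::]
  | ICard t | IRank t => set_term_sets t
  | IAdd p1 p2 => int_term_sets p1 ++ int_term_sets p2
  end.

Fixpoint free_elts (f : formula) : seq nat :=
  match f with
  | FEltEq i j => [:: i; j]
  | FSetEq t u | FSubset t u => set_term_elts t ++ set_term_elts u
  | FIntEq p q | FLe p q => int_term_elts p ++ int_term_elts q
  | FIn i t => i :: set_term_elts t
  | FNot g => free_elts g
  | FOr g h | FAnd g h => free_elts g ++ free_elts h
  | FExElt i g | FAllElt i g => [seq j <- free_elts g | j != i]
  | FExSet _ g | FAllSet _ g => free_elts g
  end.

Fixpoint free_sets (f : formula) : seq nat :=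
  match f with
  | FEltEq _ _ => [::]
  | FSetEq t u | FSubset t u => set_term_sets t ++ set_term_sets u
  | FIntEq p q | FLe p q => int_term_sets p ++ int_term_sets q
  | FIn _ t => set_term_sets t
  | FNot g => free_sets g
  | FOr g h | FAnd g h => free_sets g ++ free_sets h
  | FExElt _ g | FAllElt _ g => free_sets g
  | FExSet i g | FAllSet i g => [seq j <- free_sets g | j != i]
  end.

Definition sentence (f : formula) : Prop :=
  free_elts f = [::] /\ free_sets f = [::].

(* Assignments of element variables are partial, because the ground set may be
   empty and sentences must still be evaluated there. The values chosen below
   at undefined variables never matter: satisfaction is only used for
   assignments defined on all the free variables. *)
Section Semantics.
Variable M : structure.
Implicit Types (ex : nat -> option (ground M)) (eX : nat -> {set ground M}).

Fixpoint eval_set ex eX (t : set_term) : {set ground M} :=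
  match t with
  | SFull => [set: ground M]
  | SEmpty => set0
  | SVar i => eX i
  | SSingle i => if ex i is Some a then [set a] else set0
  | SCompl t1 => ~: eval_set ex eX t1
  | SUnion t1 t2 => eval_set ex eX t1 :|: eval_set ex eX t2
  | SInter t1 t2 => eval_set ex eX t1 :&: eval_set ex eX t2
  end.

Fixpoint eval_int ex eX (p : int_term) : nat :=
  match p with
  | IConst n => n
  | ICard t => #|eval_set ex eX t|
  | IRank t => rk (eval_set ex eX t)
  | IAdd p1 p2 => eval_int ex eX p1 + eval_int ex eX p2
  end.

Fixpoint sat ex eX (f : formula) : bool :=
  match f with
  | FEltEq i j => ex i == ex j
  | FSetEq t u => eval_set ex eX t == eval_set ex eX u
  | FSubset t u => eval_set ex eX t \subset eval_set ex eX u
  | FIntEq p q => eval_int ex eX p == eval_int ex eX q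
  | FLe p q => eval_int ex eX p <= eval_int ex eX q
  | FIn i t => if ex i is Some a then a \in eval_set ex eX t else false
  | FNot g => ~~ sat ex eX g
  | FOr g h => sat ex eX g || sat ex eX h
  | FAnd g h => sat ex eX g && sat ex eX h
  | FExElt i g => [exists a : ground M, sat [eta ex with i |-> Some a] eX g]
  | FAllElt i g => [forall a : ground M, sat [eta ex with i |-> Some a] eX g]
  | FExSet i g => [exists A : {set ground M}, sat ex [eta eX with i |-> A] g]
  | FAllSet i g => [forall A : {set ground M}, sat ex [eta eX with i |-> A] g]
  end.

Definition assigns ex (f : formula) : bool :=
  all (fun i => isSome (ex i)) (free_elts f).

Definition models (f : formula) : bool := sat (fun=> None) (fun=> set0) f.

End Semantics.

Definition equivalent (f g : formula) : Prop :=
  forall (M : structure) (ex : nat -> option (ground M))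
         (eX : nat -> {set ground M}),
    assigns ex f -> assigns ex g -> sat ex eX f = sat ex eX g.

Fixpoint quantifier_free (f : formula) : bool :=
  match f with
  | FEltEq _ _ | FSetEq _ _ | FSubset _ _ | FIntEq _ _ | FLe _ _ | FIn _ _ =>
      true
  | FNot g => quantifier_free g
  | FOr g h | FAnd g h => quantifier_free g && quantifier_free h
  | FExElt _ _ | FAllElt _ _ | FExSet _ _ | FAllSet _ _ => false
  end.

Inductive quantifier := QExists | QForall.

Definition quantify_elt (Q : quantifier) (i : nat) (f : formula) : formula :=
  match Q with QExists => FExElt i f | QForall => FAllElt i f end.

Definition quantify_set (Q : quantifier) (i : nat) (f : formula) : formula :=
  match Q with QExists => FExSet i f | QForall => FAllSet i f end.

(* One quantifier Q for the whole block of set variables, and one quantifier Q'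
   for the whole block of element variables; either block may be empty. *)
Definition M_prenex (f : formula) : Prop :=
  exists (Q Q' : quantifier) (Xs xs : seq nat) (P : formula),
    quantifier_free P /\
    f = foldr (quantify_set Q) (foldr (quantify_elt Q') P xs) Xs.

Definition M_logic (f : formula) : Prop :=
  exists2 g : formula, M_prenex g & equivalent f g.

Definition R1 : formula :=
  FAllSet 1 (FLe (IRank (SVar 1)) (ICard (SVar 1))).

Definition R2 : formula :=
  FAllSet 1 (FAllSet 2
    (FImp (FSubset (SVar 1) (SVar 2)) (FLe (IRank (SVar 1)) (IRank (SVar 2))))).

Definition R3 : formula :=
  FAllSet 1 (FAllSet 2
    (FLe (IAdd (IRank (SUnion (SVar 1) (SVar 2)))
               (IRank (SInter (SVar 1) (SVar 2))))
         (IAdd (IRank (SVar 1)) (IRank (SVar 2))))).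

(* Main.v *)
(* For any number of variables there is a family of matroids on a common ground
   set, indexed by the lines (rows and columns) of an m x m grid, such that
   - the member where all lines are circuit-hyperplanes, and those where exactly
     two lines have been relaxed, are representable over every infinite field;
   - a member where exactly one line has been relaxed is never representable.
   The legs are the broken diagonals of the grid, and a cell of leg i is the
   point e_i + w tau, where tau is the tip and the e_i sum to zero.  A
   transversal of the legs is then dependent iff its weights sum to zero; as the
   rows and the columns have the same total weight, all lines but one cannot
   have weight zero.
   Lines are pairwise far apart as sets, so once the values of the set variables
   are fixed, a prenex sentence evaluates the rank of only a bounded number of
   sets near lines.  It therefore cannot detect the relaxation of most lines: a
   witness for an existential sentence passes from the unrelaxed matroid to a
   one-line relaxation, and a counterexample to a universal one passes from a
   one-line relaxation to a two-line one. *)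
Require Import Defs.
From mathcomp Require Import all_boot all_order all_algebra zify ring.
From mathcomp Require classical_sets cardinality boolp.
From Stdlib Require List.

Set Implicit Arguments.
Unset Strict Implicit.
Unset Printing Implicit Defensive.

(** * Formulas with one block of set quantifiers *)

Fixpoint rank_terms_int (p : int_term) : seq set_term :=
  match p with
  | IConst _ | ICard _ => [::]
  | IRank t => [:: t]
  | IAdd p1 p2 => rank_terms_int p1 ++ rank_terms_int p2
  end.

Fixpoint rank_terms (f : formula) : seq set_term :=
  match f with
  | FIntEq p q | FLe p q => rank_terms_int p ++ rank_terms_int q
  | FNot g => rank_terms g
  | FOr g h | FAnd g h => rank_terms g ++ rank_terms h
  | FExElt _ g | FAllElt _ g | FExSet _ g | FAllSet _ g => rank_terms g
  | _ => [::]
  end.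

Fixpoint set_quantifier_free (f : formula) : bool :=
  match f with
  | FNot g | FExElt _ g | FAllElt _ g => set_quantifier_free g
  | FOr g h | FAnd g h => set_quantifier_free g && set_quantifier_free h
  | FExSet _ _ | FAllSet _ _ => false
  | _ => true
  end.

Lemma quantify_elt_set_quantifier_free Q xs P :
  quantifier_free P -> set_quantifier_free (foldr (quantify_elt Q) P xs).
Proof.
move=> qfP; elim: xs => [|x xs IH] /=; last by case: Q IH.
by elim: P qfP => //= [g IHg h IHh|g IHg h IHh] /andP[/IHg-> /IHh->].
Qed.

Lemma exists_notin (T : finType) (A : {set T}) :
  #|A| < #|T| -> exists x, x \notin A.
Proof.
move=> cA; apply/existsP; rewrite -negb_forall; apply: contraL cA => /forallP allA.
by rewrite -leqNgt; apply/subset_leq_card/subsetP => x _; apply: allA.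
Qed.

(** * Symmetric difference as a distance between sets *)

Section SymmetricDifference.
Variable E : finType.
Implicit Types A B C : {set E}.

Definition symdiff A B := (A :\: B) :|: (B :\: A).

Lemma in_symdiff A B x : (x \in symdiff A B) = ((x \in A) (+) (x \in B)).
Proof. by rewrite !inE; case: (x \in A); case: (x \in B). Qed.

Lemma symdiffC A B : symdiff A B = symdiff B A.
Proof. by rewrite /symdiff setUC. Qed.

Lemma symdiff_triangle A B C :
  #|symdiff A C| <= #|symdiff A B| + #|symdiff B C|.
Proof.
apply: leq_trans (leq_card_setU _ _); apply/subset_leq_card/subsetP => x.
rewrite in_setU !in_symdiff.
by case: (x \in A); case: (x \in B); case: (x \in C).
Qed.

End SymmetricDifference.

(** * Satisfaction under different rank functions on one ground set *)

Section SameGround.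
Variable E : finType.
Implicit Types (r : {set E} -> nat) (ex : nat -> option E)
  (eX : nat -> {set E}).

Lemma eval_set_rk r r' ex eX t :
  @eval_set (Structure r) ex eX t = @eval_set (Structure r') ex eX t.
Proof. by elim: t => //= [t -> //|t -> u ->|t -> u ->]. Qed.

(** An undefined element variable contributes the empty set, so membership can change only at the
    elements that [ex] assigns to the variables of [t]. *)
Lemma symdiff_eval_set r ex eX t :
  #|symdiff (@eval_set (Structure r) ex eX t)
            (@eval_set (Structure r) (fun=> None) eX t)|
    <= size (set_term_elts t).
Proof.
have sub : symdiff (@eval_set (Structure r) ex eX t)
             (@eval_set (Structure r) (fun=> None) eX t)
    \subset pmap ex (set_term_elts t).
  apply/subsetP => x; apply: contraTT => nx.
  rewrite in_symdiff; suff -> : (x \in @eval_set (Structure r) ex eX t) =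
    (x \in @eval_set (Structure r) (fun=> None) eX t) by rewrite addbb.
  elim: t nx => //= [i|t IH|t IHt u IHu|t IHt u IHu].
  - by case: (ex i) => [a|] //=; rewrite !inE => /negPf.
  - by move=> /IH eqx; rewrite !inE eqx.
  - by rewrite pmap_cat mem_cat negb_or => /andP[/IHt h1 /IHu h2];
      rewrite !inE h1 h2.
  - by rewrite pmap_cat mem_cat negb_or => /andP[/IHt h1 /IHu h2];
      rewrite !inE h1 h2.
apply: leq_trans (subset_leq_card sub) _.
by apply: leq_trans (card_size _) _; rewrite size_pmap count_size.
Qed.

Definition far_from_terms (L : nat) (Z : {set E}) r eX (f : formula) : bool :=
  all (fun t => L < #|symdiff Z (@eval_set (Structure r) (fun=> None) eX t)|)
      (rank_terms f).

Definition short_terms (L : nat) (ts : seq set_term) : bool :=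
  all (fun t => size (set_term_elts t) <= L) ts.

(* Element variables move the value of a set term by few elements, so a set
   far from all the values at the undefined element assignment is never
   evaluated. *)
Lemma sat_eq_off r r' Z L ex eX f :
    (forall X, X != Z -> r X = r' X) ->
    set_quantifier_free f -> short_terms L (rank_terms f) ->
    far_from_terms L Z r eX f ->
  @sat (Structure r) ex eX f = @sat (Structure r') ex eX f.
Proof.
move=> rr'.
pose ok t := (size (set_term_elts t) <= L) &&
  (L < #|symdiff Z (@eval_set (Structure r) (fun=> None) eX t)|).
have okrk ex1 t : ok t -> r (@eval_set (Structure r) ex1 eX t) =
    r' (@eval_set (Structure r') ex1 eX t).
  case/andP=> tL LZ; rewrite -(eval_set_rk r r') rr' //; apply/eqP => eZ.
  have := symdiff_eval_set r ex1 eX t; rewrite eZ => h.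
  by have := leq_trans LZ (leq_trans h tL); rewrite ltnn.
have okint ex1 p : all ok (rank_terms_int p) ->
    @eval_int (Structure r) ex1 eX p = @eval_int (Structure r') ex1 eX p.
  elim: p => //= [t|p IHp q IHq].
  - by rewrite andbT => /okrk.
  - by rewrite all_cat => /andP[/IHp-> /IHq->].
move=> qf sh far; have {sh far} : all ok (rank_terms f).
  by rewrite all_predI; apply/andP; split.
elim: f qf ex => //= [p q|p q|g IH|g IHg h IHh|g IHg h IHh|i g IH|i g IH] qf
  ex.
- by rewrite all_cat => /andP[/okint-> /okint->].
- by rewrite all_cat => /andP[/okint-> /okint->].
- by move=> /(IH qf)->.
- by case/andP: qf => /IHg{}IHg /IHh{}IHh; rewrite all_cat =>
    /andP[/IHg-> /IHh->].
- by case/andP: qf => /IHg{}IHg /IHh{}IHh; rewrite all_cat =>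
    /andP[/IHg-> /IHh->].
- by move=> okg; apply: eq_existsb => a; rewrite (IH qf).
- by move=> okg; apply: eq_forallb => a; rewrite (IH qf).
Qed.

(** For a sentence this trades the undefined assignment of [models] for a total one, to which
    [equivalent] always applies. *)
Lemma sat_free_elts r ex ex' eX f :
    {in free_elts f, ex =1 ex'} ->
  @sat (Structure r) ex eX f = @sat (Structure r) ex' eX f.
Proof.
have evs (ex1 ex2 : nat -> option E) eX1 t : {in set_term_elts t, ex1 =1 ex2} ->
    @eval_set (Structure r) ex1 eX1 t = @eval_set (Structure r) ex2 eX1 t.
  elim: t => //= [i h|t IH h|t IHt u IHu h|t IHt u IHu h].
  - by rewrite h // inE.
  - by rewrite IH.
  - by rewrite IHt ?IHu // => x xt; apply: h; rewrite mem_cat xt ?orbT.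
  - by rewrite IHt ?IHu // => x xt; apply: h; rewrite mem_cat xt ?orbT.
have evi (ex1 ex2 : nat -> option E) eX1 p : {in int_term_elts p, ex1 =1 ex2} ->
    @eval_int (Structure r) ex1 eX1 p = @eval_int (Structure r) ex2 eX1 p.
  elim: p => //= [t h|t h|p IHp q IHq h].
  - by rewrite (evs ex1 ex2).
  - by rewrite (evs ex1 ex2).
  - by rewrite IHp ?IHq // => x xt; apply: h; rewrite mem_cat xt ?orbT.
have upd i (ex1 ex2 : nat -> option E) a g :
    {in [seq j <- free_elts g | j != i], ex1 =1 ex2} ->
    {in free_elts g, [eta ex1 with i |-> Some a] =1 [eta ex2 with i |-> Some a]}.
  move=> h j jg /=; case: eqVneq => // ji; apply: h.
  by rewrite mem_filter ji.
elim: f ex ex' eX => //= [i j|t u|t u|p q|p q|i t|g IH|g IHg h IHh|g IHg h IHh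
  |i g IH|i g IH|i g IH|i g IH] ex ex' eX eqx.
- by rewrite !eqx // !inE eqxx ?orbT.
- by rewrite !(evs ex ex') // => x xt; apply: eqx; rewrite mem_cat xt ?orbT.
- by rewrite !(evs ex ex') // => x xt; apply: eqx; rewrite mem_cat xt ?orbT.
- by rewrite !(evi ex ex') // => x xt; apply: eqx; rewrite mem_cat xt ?orbT.
- by rewrite !(evi ex ex') // => x xt; apply: eqx; rewrite mem_cat xt ?orbT.
- rewrite eqx ?inE ?eqxx // (evs ex ex') // => x xt.
  by apply: eqx; rewrite inE xt orbT.
- by rewrite (IH ex ex').
- by rewrite (IHg ex ex') ?(IHh ex ex') // => x xt; apply: eqx;
    rewrite mem_cat xt ?orbT.
- by rewrite (IHg ex ex') ?(IHh ex ex') // => x xt; apply: eqx;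
    rewrite mem_cat xt ?orbT.
- by apply: eq_existsb => a; apply/IH/upd.
- by apply: eq_forallb => a; apply/IH/upd.
- by apply: eq_existsb => a; apply/IH.
- by apply: eq_forallb => a; apply/IH.
Qed.

(** The sets chosen for the block do not involve the rank function, so [eX'] can serve as a witness
    for every other [r'] on the same ground set. *)
Lemma sat_exists_sets r ex eX Xs h :
    @sat (Structure r) ex eX (foldr (quantify_set QExists) h Xs) ->
  exists2 eX', @sat (Structure r) ex eX' h &
    forall r', @sat (Structure r') ex eX' h ->
      @sat (Structure r') ex eX (foldr (quantify_set QExists) h Xs).
Proof.
elim: Xs eX => [|i Xs IH] eX /=; first by exists eX.
case/existsP=> A /IH [eX' s1 s2]; exists eX' => // r' s.
by apply/existsP; exists A; apply: s2.
Qed.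

Lemma sat_forall_sets r ex eX Xs h :
    ~~ @sat (Structure r) ex eX (foldr (quantify_set QForall) h Xs) ->
  exists2 eX', ~~ @sat (Structure r) ex eX' h &
    forall r', @sat (Structure r') ex eX (foldr (quantify_set QForall) h Xs) ->
      @sat (Structure r') ex eX' h.
Proof.
elim: Xs eX => [|i Xs IH] eX /=; first by exists eX.
case/forallPn=> A /IH [eX' s1 s2]; exists eX' => // r' /forallP s.
exact: s2.
Qed.

(** By the triangle inequality, two sets within [L] of the same term value are within [2 * L] of
    each other. Hence each rank term is near at most one [Z i]. *)
Lemma card_near_terms (I : finType) (Z : I -> {set E}) L r eX f :
    (forall i j, i != j -> 2 * L < #|symdiff (Z i) (Z j)|) ->
  #|[set i | ~~ far_from_terms L (Z i) r eX f]| <= size (rank_terms f).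
Proof.
move=> farZ; rewrite /far_from_terms; elim: (rank_terms f) => [|t ts IH] /=.
  by rewrite leqn0 cards_eq0; apply/eqP/setP => i; rewrite !inE.
pose W := @eval_set (Structure r) (fun=> None) eX t.
apply: (@leq_trans #|[set i | #|symdiff (Z i) W| <= L] :|:
    [set i | ~~ all (fun t0 => L < #|symdiff (Z i)
       (@eval_set (Structure r) (fun=> None) eX t0)|) ts]|).
  apply/subset_leq_card/subsetP => i.
  by rewrite !inE negb_and -leqNgt.
apply: leq_trans (leq_card_setU _ _) _; rewrite -[(size ts).+1]add1n; apply: leq_add IH.
apply/card_le1_eqP => i j; rewrite !inE => iW jW; apply/eqP.
apply/negPn/negP => /farZ; rewrite ltnNge => /negP; apply.
apply: leq_trans (symdiff_triangle _ W _) _.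
by rewrite mul2n -addnn leq_add // symdiffC.
Qed.

End SameGround.

(** * Passing sentences of M-logic between rank functions *)

Section Transfer.

(* A witness for an existential block at [r0] survives in [r1 j] for all but a
   few [j]; a counterexample to a universal block in [r1 j] survives in
   [r2 i j] for all but a few [i]. *)
Definition transfers (C L : nat) (f : formula) : Prop :=
  forall (E : finType) (x0 : E) (I : finType) (Z : I -> {set E})
    (r0 : {set E} -> nat) (r1 : I -> {set E} -> nat)
    (r2 : I -> I -> {set E} -> nat),
    (forall i j, i != j -> 2 * L < #|symdiff (Z i) (Z j)|) ->
    C.+1 < #|I| ->
    (forall j X, X != Z j -> r0 X = r1 j X) ->
    (forall i j X, i != j -> X != Z i -> r1 j X = r2 i j X) ->
    models (Structure r0) f ->
    (forall i j, i != j -> models (Structure (r2 i j)) f) ->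
  exists2 bad : {set I}, #|bad| <= C &
    forall j, j \notin bad -> models (Structure (r1 j)) f.

Lemma M_logic_transfers f :
  sentence f -> M_logic f -> exists C L, transfers C L f.
Proof.
case=> closed_f _ [g [Q [Q' [Xs [xs [P [qfP ->]]]]]] eqv].
set h := foldr (quantify_elt Q') P xs in eqv *.
have qfh : set_quantifier_free h by apply: quantify_elt_set_quantifier_free.
(* [L] bounds how far element variables can move the value of a rank term; the number of rank terms
   will bound the number of bad indices. *)
pose L := \max_(t <- rank_terms h) size (set_term_elts t).
have shL : short_terms L (rank_terms h).
  rewrite /short_terms /L; elim: (rank_terms h) => //= t ts IH.
  rewrite big_cons leq_maxl /=; apply: sub_all IH => u uL.
  exact: leq_trans uL (leq_maxr _ _).
exists (size (rank_terms h)), L => E x0 I Z r0 r1 r2 farZ cardI r01 r12.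
(* The prenex form may have free variables although [f] has none. The constant assignment [x0] is
   defined on all of them. *)
have modE r : models (Structure r) f = @sat (Structure r) (fun=> Some x0)
    (fun=> set0) (foldr (quantify_set Q) h Xs).
  rewrite -(eqv (Structure r) (fun=> Some x0)) /assigns ?closed_f //.
    by apply: sat_free_elts; rewrite closed_f.
  by elim: (free_elts _).
rewrite modE => m0 m2; case: Q modE eqv m0 => modE eqv m0.
  have [eX s0 s1] := sat_exists_sets m0.
  exists [set j | ~~ far_from_terms L (Z j) r0 eX h].
    exact: card_near_terms.
  move=> j; rewrite inE negbK => farj; rewrite modE; apply: s1.
  by rewrite -(sat_eq_off (r := r0) (Z := Z j) (L := L)) //; apply: r01.
exists set0; first by rewrite cards0.
move=> j _; rewrite modE; apply/negPn/negP => nm.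
have [eX s0 s1] := sat_forall_sets nm.
pose bad := [set i | ~~ far_from_terms L (Z i) (r1 j) eX h].
(* The index [i] must also differ from [j], which is why [#|I|] has to exceed [C.+1] and not just
   [C]. *)
have [i] : exists i, i \notin j |: bad.
  apply: exists_notin; apply: leq_ltn_trans cardI.
  apply: leq_trans (leq_card_setU _ _) _; rewrite cards1 add1n ltnS.
  exact: card_near_terms.
rewrite !inE negb_or negbK => /andP[ij far].
have := m2 i j ij; rewrite modE => /s1.
rewrite -(sat_eq_off (r := r1 j) (Z := Z i) (L := L)) ?(negPf s0) //.
by move=> X; apply: r12.
Qed.

Lemma M_logic_transfers_seq K :
    (forall f, List.In f K -> sentence f /\ M_logic f) ->
  exists C L, forall (E : finType) (x0 : E) (I : finType) (Z : I -> {set E})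
    (r0 : {set E} -> nat) (r1 : I -> {set E} -> nat)
    (r2 : I -> I -> {set E} -> nat),
    (forall i j, i != j -> 2 * L < #|symdiff (Z i) (Z j)|) ->
    C.+1 < #|I| ->
    (forall j X, X != Z j -> r0 X = r1 j X) ->
    (forall i j X, i != j -> X != Z i -> r1 j X = r2 i j X) ->
    (forall f, List.In f K -> models (Structure r0) f) ->
    (forall i j f, i != j -> List.In f K -> models (Structure (r2 i j)) f) ->
  exists2 bad : {set I}, #|bad| <= C & forall j f, j \notin bad ->
    List.In f K -> models (Structure (r1 j)) f.
Proof.
elim: K => [|f K IH] KM.
  by exists 0, 0 => *; exists set0; rewrite ?cards0.
have [|C [L tr]] := IH; first by move=> g gK; apply: KM; right.
have [sf Mf] := KM f (or_introl (erefl f)).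
have [Cf [Lf trf]] := M_logic_transfers sf Mf.
(* The exceptional sets are united, so their bounds add up. For the distances any common upper bound
   works, and the sum is one. *)
exists (Cf + C), (Lf + L) => E x0 I Z r0 r1 r2 farZ cardI r01 r12 m0 m2.
have [||||bad cb h] := tr E x0 I Z r0 r1 r2 _ _ r01 r12 _ _.
- by move=> i j /farZ; apply: leq_ltn_trans; rewrite leq_mul2l leq_addl orbT.
- by apply: leq_ltn_trans cardI; rewrite ltnS leq_addl.
- by move=> g gK; apply: m0; right.
- by move=> i j g ij gK; apply: m2 => //; right.
have [||||badf cbf hf] := trf E x0 I Z r0 r1 r2 _ _ r01 r12 _ _.
- by move=> i j /farZ; apply: leq_ltn_trans; rewrite leq_mul2l leq_addr orbT.
- by apply: leq_ltn_trans cardI; rewrite ltnS leq_addr.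
- by apply: m0; left.
- by move=> i j ij; apply: m2 => //; left.
exists (badf :|: bad).
  exact: leq_trans (leq_card_setU _ _) (leq_add cbf cb).
move=> j g; rewrite inE negb_or => /andP[jf jb] [<-|gK]; first exact: hf.
exact: h.
Qed.

End Transfer.

Import GRing.Theory.
Local Open Scope ring_scope.

(** * Representations with a tip and legs *)

Section FamilyRank.
Variables (F : fieldType) (V : vectType F) (E : finType) (phi : E -> V).
Implicit Types S T : {set E}.

Definition fam_dim S : nat := \dim <<[seq phi s | s in S]>>.

Lemma fam_dim_card S : (fam_dim S <= #|S|)%N.
Proof. by apply: leq_trans (dim_span _) _; rewrite size_image. Qed.

Lemma fam_span_sub S T : S \subset T ->
  (<<[seq phi s | s in S]>> <= <<[seq phi s | s in T]>>)%VS.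
Proof.
move=> /subsetP sST; apply: sub_span => _ /imageP[x xS ->].
by apply/imageP; exists x => //; apply: sST.
Qed.

Lemma fam_dim_sub S T : S \subset T -> (fam_dim S <= fam_dim T)%N.
Proof. by move=> sST; apply/dimvS/fam_span_sub. Qed.

Lemma fam_span_mem S x : x \in S -> phi x \in <<[seq phi s | s in S]>>%VS.
Proof. by move=> xS; apply/memv_span/imageP; exists x. Qed.

(** Translates [free], whose coefficients are indexed by positions in a sequence, into relations
    indexed by elements of the ground set. Elements with equal vectors remain distinct in such
    relations. *)
Lemma fam_freeP S :
  (forall c : E -> F, \sum_(s in S) c s *: phi s = 0 -> {in S, c =1 fun=> 0})
  <-> fam_dim S = #|S|.
Proof.
have frE : free [seq phi s | s in S] = (fam_dim S == #|S|).
  by rewrite /free size_image.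
have nthE (k : 'I_#|S|) : [seq phi s | s in S]`_k = phi (enum_val k).
  rewrite (nth_map (enum_val k)) -?cardE //; congr phi.
  by rewrite -enum_val_nth.
split=> [indep|/eqP]; last rewrite -frE => fr c cS s sS.
  apply/eqP; rewrite -frE; apply/(@freeP _ _ _ (in_tuple [seq phi s | s in S])).
  rewrite /= size_image => k kS i.
  pose c s := if [pick j : 'I_#|S| | enum_val j == s] is Some j then k j else 0.
  have cE j : c (enum_val j) = k j.
    rewrite /c; case: pickP => [j' /eqP/enum_val_inj->//|/(_ j)].
    by rewrite eqxx.
  rewrite -cE; apply: indep (enum_valP i).
  rewrite big_enum_val -[RHS]kS; apply: eq_bigr => j _.
  by rewrite cE nthE.
have fr' : free (in_tuple [seq phi s | s in S]) by [].
move/freeP: fr'; rewrite /= size_image => fr'.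
rewrite -(enum_rankK_in sS sS); apply: (fr' (fun i => c (enum_val i))).
rewrite -[RHS]cS [RHS]big_enum_val; apply: eq_bigr => j _.
by rewrite nthE.
Qed.

(** This is the dimension formula for the sum and the intersection of two subspaces. The span of
    [S :&: T] may be smaller than the intersection of the two spans. *)
Lemma fam_dim_submod S T :
  (fam_dim (S :|: T) + fam_dim (S :&: T) <= fam_dim S + fam_dim T)%N.
Proof.
rewrite /fam_dim -[leqRHS]dimv_sum_cap; apply: leq_add; apply: dimvS.
  apply/span_subvP => _ /imageP[x xST ->].
  by case/setUP: xST => xST; [rewrite -[phi x]addr0|rewrite -[phi x]add0r];
    rewrite memv_add ?mem0v ?fam_span_mem.
by rewrite subv_cap !fam_span_sub ?subsetIl ?subsetIr.
Qed.

End FamilyRank.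

(** * Rank of a family made of a tip and points on legs through it *)

Section Spike.
Variables (m : nat) (C : finType) (leg : C -> 'I_m).
Hypothesis m_gt0 : (0 < m)%N.
Implicit Types X : {set option C}.

Definition cells X : {set C} := Some @^-1: X.
Definition legs X : {set 'I_m} := leg @: cells X.

Lemma card_cells X : #|X| = ((None \in X) + #|cells X|)%N.
Proof.
rewrite (cardsD1 None) -[#|cells X|](card_imset _ (@Some_inj _)); congr (_ + _)%N.
apply: eq_card => -[c|]; rewrite !inE /=.
  apply/idP/imsetP => [cX|[c' + [->]]]; last by rewrite inE.
  by exists c; rewrite ?inE.
by apply/esym/imsetP => -[].
Qed.

Lemma card_legs X : (#|legs X| <= m)%N.
Proof. by rewrite -[leqRHS]card_ord max_card. Qed.

Lemma card_legs_eq X : (#|legs X| == #|X|) ->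
  None \notin X /\ {in cells X &, injective leg}.
Proof.
rewrite card_cells => /eqP e.
have : (#|legs X| <= #|cells X|)%N by apply: leq_imset_card.
rewrite e; case: (None \in X) e => //= e; first by rewrite add1n ltnn.
by move=> _; split=> //; apply/imset_injP/eqP.
Qed.

Variables (F : fieldType) (V : vectType F).
Variables (e : 'I_m -> V) (tau : V).
Hypothesis e_sum : \sum_i e i = 0.
Hypothesis e_free : forall (c : 'I_m -> F) d,
  \sum_i c i *: e i + d *: tau = 0 -> d = 0 /\ forall i j, c i = c j.
Variables (a w : C -> F).
Hypothesis a_neq0 : forall c, a c != 0.

(** The nonzero scalars [a] do not affect rank. They are kept so that a given representation can
    later be written literally in this form. *)
Definition spike_vec (x : option C) : V :=
  if x is Some c then a c *: (e (leg c) + w c *: tau) else tau.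

Lemma sum_legs (Y : {set C}) (k : C -> F) :
  \sum_(y in Y) k y *: e (leg y)
    = \sum_i (\sum_(y in Y | leg y == i) k y) *: e i.
Proof.
rewrite (partition_big leg predT) //=; apply: eq_bigr => i _.
by rewrite scaler_suml; apply: eq_bigr => y /andP[_ /eqP->].
Qed.

Lemma sum_cells X (f : option C -> V) : None \notin X ->
  \sum_(x in X) f x = \sum_(y in cells X) f (Some y).
Proof.
move=> nX; have -> : X = Some @: cells X.
  apply/setP=> -[c|]; last by rewrite (negPf nX); apply/esym/imsetP => -[].
  by rewrite mem_imset ?inE //; apply: Some_inj.
rewrite big_imset /=; last by move=> ? ? _ _ [].
apply: eq_bigl => y; rewrite !inE mem_imset ?inE //; exact: Some_inj.
Qed.

(** The cardinality condition says that [X] avoids the tip and meets each leg at most once, so each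
    [e i] receives at most one term. By [e_free] the coefficient of [tau] vanishes and those of the
    [e i] all agree; a leg missed by [X] makes their common value zero. *)
Lemma untipped_relation X (c : option C -> F) :
    #|legs X| == #|X| -> \sum_(x in X) c x *: spike_vec x = 0 ->
  [/\ {in cells X &, forall y z, c (Some y) * a y = c (Some z) * a z},
      \sum_(y in cells X) c (Some y) * a y * w y = 0
    & (#|X| < m)%N -> {in X, c =1 fun=> 0}].
Proof.
move=> /[dup] /eqP lX /card_legs_eq [nX injX].
rewrite sum_cells //= => rel.
pose k y := c (Some y) * a y.
have : \sum_i (\sum_(y in cells X | leg y == i) k y) *: e i +
    (\sum_(y in cells X) k y * w y) *: tau = 0.
  rewrite -sum_legs scaler_suml -big_split /= -[RHS]rel.
  by apply: eq_bigr => y _; rewrite /k scalerA scalerDr scalerA.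
case/e_free => -> const.
have kE y : y \in cells X -> \sum_(z in cells X | leg z == leg y) k z = k y.
  move=> yX; rewrite (bigD1 y) /=; last by rewrite yX eqxx.
  rewrite big1 ?addr0 // => z /andP[/andP[zX /eqP/injX eqz]] /eqP[].
  exact: eqz.
have kk : {in cells X &, forall y z, k y = k z}.
  by move=> y z yX zX; rewrite -kE // -[RHS]kE // (const (leg y) (leg z)).
split=> // Xm [y yX|]; last by rewrite (negPf nX).
have yc : y \in cells X by rewrite inE.
have [i iX] : exists i, i \notin legs X.
  by apply: exists_notin; rewrite lX card_ord.
have : k y = 0.
  rewrite -kE // (const _ i) big1 // => z /andP[zX /eqP zi].
  by case/negP: iX; rewrite -zi; apply: imset_f.
by move/eqP; rewrite mulf_eq0 (negPf (a_neq0 y)) orbF => /eqP.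
Qed.

Lemma fam_dim_untipped X : #|legs X| == #|X| ->
  fam_dim spike_vec X =
    (#|X| - ((#|X| == m) && (\sum_(y in cells X) w y == 0)%R))%N.
Proof.
move=> lX; have [nX injX] := card_legs_eq lX.
have freeX : ~~ ((#|X| == m) && (\sum_(y in cells X) w y == 0)) ->
    fam_dim spike_vec X = #|X|.
  move=> nz; apply/fam_freeP => c /(untipped_relation lX) [cc cw cX].
  have [/cX//|mX] := ltnP #|X| m.
  have Xm : #|X| = m by apply/eqP; rewrite eqn_leq mX andbT -(eqP lX) card_legs.
  rewrite Xm eqxx /= in nz.
  case=> [y yX|]; last by rewrite (negPf nX).
  have yc : y \in cells X by rewrite inE.
  have : c (Some y) * a y * \sum_(z in cells X) w z = 0.
    by rewrite mulr_sumr -[RHS]cw; apply: eq_bigr => z zX; rewrite (cc y z).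
  by move/eqP; rewrite !mulf_eq0 (negPf nz) (negPf (a_neq0 y)) !orbF => /eqP.
case: (boolP (_ && _)) freeX => [/andP[/eqP Xm w0] _|_ ->]; rewrite ?subn0 //.
rewrite /= subn1.
have legsT : legs X = setT.
  by apply/eqP; rewrite eqEcard subsetT cardsT card_ord (eqP lX) Xm leqnn.
apply/eqP; rewrite eqn_leq; apply/andP; split.
  rewrite -ltnS prednK ?Xm // ltn_neqAle -{2}Xm fam_dim_card andbT -Xm.
  apply/negP => /eqP/fam_freeP free_vec.
  (* These coefficients turn each vector into [e (leg y) + w y *: tau]. Over a full transversal the
     [e] parts cancel by [e_sum], and the weights sum to zero. *)
  pose c x : F := if x is Some y then (a y)^-1 else 0.
  have : {in X, c =1 fun=> 0}.
    apply: free_vec; rewrite sum_cells //=.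
    under eq_bigr do rewrite scalerA mulVf // scale1r.
    rewrite big_split /= -scaler_suml (eqP w0) scale0r addr0.
    rewrite -[RHS]e_sum -(big_imset _ injX) /=; apply: eq_bigl => i.
    by rewrite -/(legs X) legsT inE.
  have /card_gt0P[[y|] yX] : (0 < #|X|)%N by rewrite Xm.
    by move/(_ _ yX)/eqP; rewrite invr_eq0 (negPf (a_neq0 y)).
  by rewrite yX in nX.
have /card_gt0P[[y|] yX] : (0 < #|X|)%N by rewrite Xm.
  2: by rewrite yX in nX.
have yc : y \in cells X by rewrite inE.
(* For the lower bound, deleting one cell leaves a leg unmet, so the remaining vectors are
   independent. *)
have cD : #|X :\ Some y| = #|X|.-1 by rewrite (cardsD1 (Some y) X) yX.
have lD : #|legs (X :\ Some y)| == #|X :\ Some y|.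
  have cellsD : cells (X :\ Some y) = cells X :\ y.
    by apply/setP => z; rewrite !inE.
  rewrite /legs cellsD card_in_imset; last first.
    by move=> u v /setD1P[_ uX] /setD1P[_ vX]; apply: injX.
  have -> : #|cells X :\ y| = #|cells X|.-1 by rewrite (cardsD1 y (cells X)) yc.
  by rewrite cD card_cells (negPf nX).
have : fam_dim spike_vec (X :\ Some y) = #|X :\ Some y|.
  apply/fam_freeP => c /(untipped_relation lD)[_ _]; apply.
  by rewrite cD Xm prednK.
by rewrite cD => <-; apply: fam_dim_sub; apply: subsetDl.
Qed.

Hypothesis w_inj : forall y z, leg y = leg z -> w y = w z -> y = z.

(** If the tip is not in [X], two cells of [X] share a leg. Their weights differ by [w_inj], so the
    difference of their rescaled vectors is a nonzero multiple of [tau]. *)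
Lemma tipped_mem X : #|legs X| != #|X| ->
  tau \in <<[seq spike_vec x | x in X]>>%VS.
Proof.
move=> lX; have [nX|nX] := boolP (None \in X).
  exact: (fam_span_mem spike_vec nX).
have cX : #|X| = #|cells X| by rewrite card_cells (negPf nX).
have /dinjectivePn[y yX [z zX eqyz]] : ~~ dinjectiveb leg (cells X).
  apply: contra lX => /dinjectiveP injX.
  by rewrite cX; apply/imset_injP.
case/andP: zX => zy zX.
have wyz : w y - w z != 0.
  by rewrite subr_eq0; apply: contra zy => /eqP/(w_inj eqyz)->.
have vE u : u \in cells X ->
    e (leg u) + w u *: tau \in <<[seq spike_vec x | x in X]>>%VS.
  rewrite inE => /(fam_span_mem spike_vec)/(memvZ (a u)^-1).
  by rewrite /= scalerA mulVf // scale1r.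
have := memvZ (w y - w z)^-1 (memvB (vE y yX) (vE z zX)).
rewrite eqyz opprD addrACA subrr add0r -scalerBl scalerA mulVf // scale1r.
by [].
Qed.

(** Once [tau] is in the span, each cell can be replaced by the vector [e i] of its leg. These
    vectors and [tau] are independent unless every leg occurs, when [e_sum] costs one dimension;
    this is the minimum with [m]. *)
Lemma fam_dim_tipped X : #|legs X| != #|X| ->
  fam_dim spike_vec X = minn m #|legs X|.+1.
Proof.
move=> lX; have tX := tipped_mem lX.
pose g (x : option 'I_m) := if x is Some i then e i else tau.
pose gs (L : {set 'I_m}) : {set option 'I_m} := None |: Some @: L.
have cgs L : #|gs L| = #|L|.+1.
  rewrite cardsU1 card_imset ?add1n; last exact: Some_inj.
  by rewrite (_ : None \notin _) //; apply/imsetP => -[].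
have gfree (L : {set 'I_m}) : (#|L| < m)%N -> fam_dim g (gs L) = #|L|.+1.
  move=> Lm; rewrite -cgs; apply/fam_freeP => c.
  rewrite big_setU1 /=; last by apply/imsetP => -[].
  rewrite big_imset /=; last by move=> ? ? _ _ [].
  move=> rel.
  (* The coefficients are extended by zero; a leg outside [L] then forces their common value to be
     zero. *)
  have [|c0 const] := @e_free (fun i => if i \in L then c (Some i) else 0)
    (c None).
    rewrite addrC -[RHS]rel; congr (_ + _).
    rewrite [RHS]big_mkcond; apply: eq_bigr => i _.
    by case: ifP => //; rewrite scale0r.
  have [i iL] : exists i, i \notin L by apply: exists_notin; rewrite card_ord.
  case=> [j|]; rewrite // /gs !inE /= => /imsetP[j' jL [->]].
  by have := const j' i; rewrite jL (negPf iL).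
have -> : fam_dim spike_vec X = fam_dim g (gs (legs X)).
  congr (\dim _); apply/eqP; rewrite eqEsubv; apply/andP; split.
    apply/span_subvP => _ /imageP[[y|] yX ->] /=; last first.
      by apply: (fam_span_mem g (x := None)); rewrite setU11.
    apply/memvZ/memvD; last first.
      by apply/memvZ/(fam_span_mem g (x := None)); rewrite setU11.
    apply: (fam_span_mem g (x := Some (leg y))); rewrite inE; apply/orP; right.
    by apply/imset_f/imset_f; rewrite inE.
  apply/span_subvP => _ /imageP[[i|] iX ->] //=.
  have {iX} : i \in legs X.
    by move: iX; rewrite !inE /= mem_imset //; exact: Some_inj.
  case/imsetP => y; rewrite inE => yX ->.
  rewrite -[e _](addrK (w y *: tau)) memvB ?(memvZ _ tX) //.
  have := memvZ (a y)^-1 (fam_span_mem spike_vec yX).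
  by rewrite /= scalerA mulVf // scale1r.
have [lm|ml] := ltnP #|legs X| m; first by rewrite gfree // (minn_idPr _).
have legsT : legs X = setT.
  by apply/eqP; rewrite eqEcard subsetT cardsT card_ord.
pose i0 : 'I_m := Ordinal m_gt0.
have cD : #|[set: 'I_m] :\ i0|.+1 = m.
  by rewrite -[RHS]card_ord -cardsT (cardsD1 i0 setT) inE.
rewrite (minn_idPl _) ?leqW //; apply: (etrans _ cD).
rewrite -[RHS]gfree; last by rewrite cD.
rewrite legsT; congr (\dim _); apply/eqP; rewrite eqEsubv; apply/andP; split.
  apply/span_subvP => _ /imageP[[i|] _ ->] /=; last first.
    by apply: (fam_span_mem g (x := None)); rewrite setU11.
  have memi j : j != i0 -> e j \in <<[seq g x | x in gs (setT :\ i0)]>>%VS.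
    move=> ji; apply: (fam_span_mem g (x := Some j)).
    by rewrite inE; apply/orP; right; apply: imset_f; rewrite !inE ji.
  have [->|/memi//] := eqVneq i i0.
  have -> : e i0 = - \sum_(j | j != i0) e j.
    by apply/eqP; rewrite -addr_eq0 -[X in _ == X]e_sum [X in _ == X](bigD1 i0) //=.
  by rewrite memvN memv_suml.
apply: (fam_span_sub g); apply: setUS; apply: imsetS; exact: subsetT.
Qed.

End Spike.

(** * The grid matroids *)

Lemma infinite_field_notin (F : fieldType) (s : seq F) :
  infinite_field F -> exists c, c \notin s.
Proof.
move=> infF; apply: boolp.contrapT => /boolp.forallNP all_in; apply: infF.
apply/cardinality.finite_seqP; exists s; apply/classical_sets.seteqP; split=> // x _ /=.
by apply/negPn/negP => /all_in.
Qed.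

(** A space over an infinite field is not a finite union of proper hyperplanes. A vector good for
    the earlier functionals is moved along a line on which the new one is not constant; each
    functional excludes at most one parameter [c]. *)
Lemma infinite_field_avoid (F : fieldType) (V : lmodType F) (W : V -> Prop)
    (I : eqType) (f : I -> V -> F) (s : seq I) :
    infinite_field F -> W 0 ->
    (forall u v c, W u -> W v -> W (u + c *: v)) ->
    (forall i u v c, f i (u + c *: v) = f i u + c * f i v) ->
    (forall i, i \in s -> exists2 v, W v & f i v != 0) ->
  exists2 w, W w & forall i, i \in s -> f i w != 0.
Proof.
move=> infF W0 WD fD; elim: s => [|i s IH] sW; first by exists 0.
have [|u Wu us] := IH; first by move=> j js; apply: sW; rewrite inE js orbT.
have [|v Wv vi] := sW i; first by rewrite inE eqxx.
have [c cn] := infinite_field_notin [seq - f j u / f j v | j <- i :: s] infF.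
have cE j : j \in i :: s -> f j v != 0 -> f j (u + c *: v) != 0.
  move=> js vj; rewrite fD addrC addr_eq0; apply: contra cn => /eqP cv.
  by apply/mapP; exists j; rewrite // -cv mulfK.
exists (u + c *: v); first exact: WD.
move=> j js; have [vj|/(cE j js)//] := eqVneq (f j v) 0.
rewrite fD vj mulr0 addr0; apply: us.
by case/predU1P: js vj vi => [->|//] ->; rewrite eqxx.
Qed.

Lemma exists_frame (F : fieldType) (p : nat) :
  exists (e : 'I_p.+1 -> 'rV[F]_p.+1) (tau : 'rV[F]_p.+1),
    \sum_i e i = 0 /\
    forall (c : 'I_p.+1 -> F) d, \sum_i c i *: e i + d *: tau = 0 ->
      d = 0 /\ forall i j, c i = c j.
Proof.
(* Coordinate [ord0] is reserved for the tip. The other [e i] are unit vectors, and [e ord0] is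
   minus their sum. *)
pose e (i : 'I_p.+1) : 'rV[F]_p.+1 :=
  \row_k (if k == ord0 then 0 else (i == k)%:R - (i == ord0)%:R).
have sumd (c : 'I_p.+1 -> F) k : \sum_i c i * (i == k)%:R = c k.
  rewrite (bigD1 k) //= eqxx mulr1 big1 ?addr0 // => i /negPf->.
  by rewrite mulr0.
have se c k : k != ord0 -> (\sum_i c i *: e i) 0 k = c k - c ord0.
  move=> k0; rewrite summxE -(sumd c k) -(sumd c ord0) -sumrB.
  by apply: eq_bigr => i _; rewrite !mxE (negPf k0) mulrBr.
have se0 c : (\sum_i c i *: e i) 0 ord0 = 0.
  by rewrite summxE big1 // => i _; rewrite !mxE eqxx mulr0.
exists e, (delta_mx 0 ord0); split=> [|c d rel].
  apply/rowP => k; rewrite [RHS]mxE.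
  have -> : \sum_i e i = \sum_i 1 *: e i by apply: eq_bigr => i; rewrite scale1r.
  have [->|k0] := eqVneq k ord0; first exact: (se0 (fun=> 1)).
  by rewrite (se (fun=> 1)) // subrr.
have rk k : (\sum_i c i *: e i) 0 k + d * (k == ord0)%:R = 0.
  by have := congr1 (fun v : 'rV[F]_p.+1 => v 0 k) rel; rewrite !mxE.
split; first by have := rk ord0; rewrite se0 add0r eqxx mulr1.
suff c0 i : c i = c ord0 by move=> i j; rewrite !c0.
have [->//|i0] := eqVneq i ord0.
by have := rk i; rewrite se // (negPf i0) mulr0 addr0 => /eqP; rewrite subr_eq0 => /eqP.
Qed.

(** * Lines and broken diagonals of the grid *)

Section Grid.
Variable n : nat.
Local Notation m := n.+3.
Local Notation cell := ('I_m * 'I_m)%type.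
Local Notation direction := ('I_m + 'I_m)%type.
Implicit Types (k l : direction) (T : {set cell}).

(** Subtraction in ['I_m] is modulo [m], so every row and every column meets each broken diagonal
    exactly once; [line_point] gives the common cell. *)
Definition diagonal (c : cell) : 'I_m := c.1 - c.2.

Definition line_point k (i : 'I_m) : cell :=
  match k with inl a => (a, a - i) | inr b => (b + i, b) end.

Definition on_line k (c : cell) : bool :=
  match k with inl a => c.1 == a | inr b => c.2 == b end.

Definition line k : {set cell} := [set c | on_line k c].

Lemma diagonal_line_point k i : diagonal (line_point k i) = i.
Proof. by case: k => a; rewrite /diagonal /= ?subKr // addrC addKr. Qed.

Lemma line_pointK k c : on_line k c -> line_point k (diagonal c) = c.
Proof.
by case: k => a; case: c => x y /= /eqP->; rewrite /diagonal /= ?subKr ?subrKC.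
Qed.

Lemma lineE k : line k = [set line_point k i | i : 'I_m].
Proof.
apply/setP => c; rewrite inE; apply/idP/imsetP => [kc|[i _ ->]].
  by exists (diagonal c); rewrite ?line_pointK.
by case: k => a /=.
Qed.

Lemma line_point_inj k : injective (line_point k).
Proof. exact: (can_inj (diagonal_line_point k)). Qed.

Lemma diagonal_line_inj k : {in line k &, injective diagonal}.
Proof.
move=> c d; rewrite !inE => /line_pointK cE /line_pointK dE eqcd.
by rewrite -cE -dE eqcd.
Qed.

Lemma card_line k : #|line k| = m.
Proof. by rewrite lineE card_imset ?card_ord //; apply: line_point_inj. Qed.

Lemma card_lineI k l : k != l -> (#|line k :&: line l| <= 1)%N.
Proof.
move=> kl; apply/card_le1_eqP => -[x y] [x' y']; rewrite !inE.
case: k l kl => [a|a] [b|b] /= kl /andP[/eqP e1 /eqP e2] /andP[/eqP e3 /eqP e4];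
  subst; rewrite ?eqxx // in kl *.
Qed.

Definition circuit k : {set option cell} := Some @: line k.

Lemma circuit_inj : injective circuit.
Proof.
move=> k l /(imset_inj (@Some_inj _)) eqkl; apply/eqP/negPn/negP => /card_lineI.
by rewrite eqkl setIid card_line.
Qed.

Lemma card_symdiff_circuit k l : k != l ->
  (n.+2 <= #|symdiff (circuit k) (circuit l)|)%N.
Proof.
move=> kl; apply: (@leq_trans #|circuit k :\: circuit l|); last first.
  by apply/subset_leq_card/subsetUl.
have : #|circuit k :&: circuit l| = #|line k :&: line l|.
  rewrite -imsetI; first by rewrite card_imset //; apply: Some_inj.
  by move=> ? ? _ _ [].
have := card_lineI kl; rewrite cardsD card_imset ?card_line; last exact: Some_inj.
lia.
Qed.

Lemma cells_circuit k : cells (circuit k) = line k.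
Proof.
by apply/setP => c; rewrite inE mem_imset //; apply: Some_inj.
Qed.

Lemma card_circuit k : #|circuit k| = m.
Proof. by rewrite card_imset ?card_line //; apply: Some_inj. Qed.

Lemma eq_circuit k (X : {set option cell}) :
  None \notin X -> cells X = line k -> X = circuit k.
Proof.
move=> nX cX; apply/setP => -[c|].
  by rewrite mem_imset -?cX ?inE //; apply: Some_inj.
by rewrite (negPf nX); apply/esym/imsetP => -[].
Qed.

(* The spike-like matroid whose tip is [None], whose legs are the broken
   diagonals, and whose circuit-hyperplanes avoiding the tip are the rows and
   columns in [J]. *)
Definition grid_rank (J : {set direction}) (X : {set option cell}) : nat :=
  if #|legs diagonal X| == #|X| then (#|X| - (X \in circuit @: J))%N
  else minn m #|legs diagonal X|.+1.

Lemma grid_rank_off (J J' : {set direction}) k X :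
  J :\ k = J' :\ k -> X != circuit k -> grid_rank J X = grid_rank J' X.
Proof.
move=> JJ' Xk; rewrite /grid_rank; suff -> : (X \in circuit @: J) =
  (X \in circuit @: J') by [].
have imD (J0 : {set direction}) : (X \in circuit @: J0) = (X \in circuit @: (J0 :\ k)).
  apply/imsetP/imsetP => -[l]; last by case/setD1P => _; exists l.
  move=> lJ eX; exists l => //; rewrite !inE lJ andbT.
  by apply: contraNneq Xk => <-; rewrite eX.
by rewrite imD JJ' -imD.
Qed.

(** The last two conditions on [w] make the lines in [J] the only full transversals of weight zero.
    The first is the one needed to recover the tip from two cells of a leg. *)
Lemma grid_representable (F : fieldType) (J : {set direction}) (w : cell -> F) :
    (forall y z, diagonal y = diagonal z -> w y = w z -> y = z) ->
    (forall k, (\sum_(y in line k) w y == 0) = (k \in J)) ->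
    (forall T, #|T| = m -> (forall k, T != line k) -> \sum_(y in T) w y != 0) ->
  representable F (Structure (grid_rank J)).
Proof.
move=> w_inj wJ wT; have [e [tau [e_sum e_free]]] := exists_frame F n.+2.
have a_neq0 (c : cell) : (1 : F) != 0 by apply: oner_neq0.
exists 'rV[F]_m, (spike_vec diagonal e tau (fun=> 1) w) => X.
rewrite -/(fam_dim _ _) /= /grid_rank.
have [lX|lX] := ifPn; last first.
  by rewrite (fam_dim_tipped (ltn0Sn _) e_sum e_free).
rewrite (fam_dim_untipped (ltn0Sn _) e_sum e_free) //; congr (_ - nat_of_bool _)%N.
have [nX _] := card_legs_eq lX.
apply/imsetP/andP => [[k kJ ->]|[/eqP Xm w0]].
  by rewrite cells_circuit wJ card_circuit.
have cX : #|cells X| = m by move: Xm; rewrite card_cells (negPf nX).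
have [/forallP nl|] := boolP [forall k, cells X != line k].
  by rewrite (negPf (wT _ cX nl)) in w0.
case/forallPn => k; rewrite negbK => /eqP eqX.
by exists k; [rewrite -wJ -eqX|apply: eq_circuit].
Qed.

(* A 0/1 matrix all of whose 2x2 minors have even weight has rows equal to the
   first row or to its complement; the weight [n.+3] then forces a full row or
   a full column. *)
Lemma even_minors_line T : #|T| = m ->
    (forall a a' b b', ~~ (((a, b) \in T) (+) ((a, b') \in T) (+)
                           ((a', b) \in T) (+) ((a', b') \in T))) ->
  exists k, T = line k.
Proof.
move=> Tm even; pose t b := (ord0, b) \in T.
(* [t] is the first row, and [s a] tells whether row [a] is its complement. *)
pose s a := t ord0 (+) ((a, ord0) \in T).
have tE a b : ((a, b) \in T) = t b (+) s a.
  have := even ord0 a ord0 b; rewrite /s /t.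
  by case: (_ \in T); case: (_ \in T); case: (_ \in T); case: (_ \in T).
have s0 : s ord0 = false by rewrite /s /t addbb.
pose c := #|[set b | t b]|; pose q := #|[set a | s a]|.
have cardN (P : pred 'I_m) : #|[set b | ~~ P b]| = (m - #|[set b | P b]|)%N.
  rewrite [LHS]cardsCs card_ord; congr (_ - _)%N.
  by apply: eq_card => b; rewrite !inE negbK.
have rowE a : (\sum_(x in T | x.1 == a) 1)%N = #|[set b | t b (+) s a]|.
  have pairI : injective (pair a : 'I_m -> cell) by move=> b b' [].
  rewrite sum1dep_card -(card_imset _ pairI).
  apply: eq_card => -[x y]; rewrite !inE /=.
  apply/andP/imsetP => [[xT /eqP xa]|[b + [-> ->]]].
    by exists y; rewrite ?xa // inE -tE -xa.
  by rewrite inE -tE eqxx.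
have count : (q * (m - c) + (m - q) * c = m)%N.
  rewrite -[RHS]Tm -sum1_card (partition_big fst predT) //= (bigID s) /=.
  rewrite /c /q -!cardN; congr (_ + _)%N; rewrite -sum_nat_const.
    rewrite big_set /=; apply: eq_bigr => a sa; rewrite rowE (sa : s a).
    by apply: eq_card => b; rewrite !inE addbT.
  rewrite big_set /=; apply: eq_bigr => a sa; rewrite rowE (negPf (sa : ~~ s a)).
  by apply: eq_card => b; rewrite !inE addbF.
have cm : (c <= m)%N by rewrite -[leqRHS]card_ord max_card.
have qm : (q < m)%N.
  by rewrite -[ltnRHS]card_ord -cardsT; apply: proper_card; apply/properP;
    split; [exact: subsetT|exists ord0; rewrite inE ?s0].
(* If [q], [c] and [m - c] are all positive, then [count] gives [m - c = 1] and [c = 1],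
   contradicting that [m] is at least 3. The extreme values leave the three listed cases. *)
have : [|| (c == 0) && (q == 1), (c == m) && (m - q == 1)
         | (c == 1) && (q == 0)]%N.
  nia.
case/or3P=> /andP[/eqP e1 /eqP e2].
- have /cards1P[a sa] : #|[set a | s a]| == 1%N by rewrite -/q e2.
  exists (inl a); apply/setP => -[x y]; rewrite tE inE /=.
  have := in_set1 x a; rewrite -sa inE => <-.
  suff -> : t y = false by [].
  by apply/negbTE/negP => ty; move/eqP: e1; rewrite cards_eq0 => /eqP/setP/(_ y);
    rewrite !inE ty.
- have /cards1P[a sa] : #|[set a | ~~ s a]| == 1%N by rewrite cardN -/q e2.
  exists (inl a); apply/setP => -[x y]; rewrite tE inE /=.
  have := in_set1 x a; rewrite -sa inE => <-.
  suff -> : t y = true by [].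
  have /eqP/setP/(_ y) : [set b | t b] == setT.
    by rewrite eqEcard subsetT cardsT card_ord -/c e1 leqnn.
  by rewrite !inE.
- have /cards1P[b tb] : #|[set b | t b]| == 1%N by rewrite -/c e1.
  exists (inr b); apply/setP => -[x y]; rewrite tE inE /=.
  have := in_set1 y b; rewrite -tb inE => <-.
  suff -> : s x = false by rewrite addbF.
  by apply/negbTE/negP => sx; move/eqP: e2; rewrite cards_eq0 => /eqP/setP/(_ x);
    rewrite !inE sx.
Qed.

(** * Generic weights with prescribed vanishing on lines *)

Section Weights.
Variable F : fieldType.
Implicit Types (v w : {ffun cell -> F}).

Definition cell_delta (c : cell) : {ffun cell -> F} := [ffun x => (x == c)%:R].

Lemma sum_cell_delta T c : \sum_(y in T) cell_delta c y = (c \in T)%:R.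
Proof.
rewrite big_mkcond /= (bigD1 c) //= big1 ?addr0 => [|y /negPf yc].
  by rewrite ffunE eqxx; case: (c \in T).
by rewrite ffunE yc; case: ifP.
Qed.

(** The signed corners of a rectangle. All its line sums vanish, so it can serve as a test weight
    whatever set of lines is required to have weight zero. *)
Definition cell_minor (a a' b b' : 'I_m) : {ffun cell -> F} :=
  cell_delta (a, b) - cell_delta (a, b') - cell_delta (a', b) + cell_delta (a', b').

Lemma sum_cell_minor T a a' b b' :
  \sum_(y in T) cell_minor a a' b b' y =
    ((a, b) \in T)%:R - ((a, b') \in T)%:R - ((a', b) \in T)%:R
      + ((a', b') \in T)%:R.
Proof.
rewrite -!sum_cell_delta -!sumrB -big_split /=.
by apply: eq_bigr => y _; rewrite !ffunE.
Qed.

Lemma sum_line_minor a a' b b' l :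
  \sum_(y in line l) cell_minor a a' b b' y = 0.
Proof.
rewrite sum_cell_minor !inE; case: l => c /=; first by rewrite subrr sub0r addNr.
by rewrite addrAC subrK subrr.
Qed.

(** One or three of the balanced signs survive, and in either case their sum is 1 or -1, nonzero in
    every characteristic. *)
Lemma sum_minor_odd T a a' b b' :
    ((a, b) \in T) (+) ((a, b') \in T) (+) ((a', b) \in T) (+) ((a', b') \in T) ->
  \sum_(y in T) cell_minor a a' b b' y != 0.
Proof.
rewrite sum_cell_minor.
by case: (_ \in T); case: (_ \in T); case: (_ \in T); case: (_ \in T) => //= _;
  rewrite ?(subrr, subr0, sub0r, addr0, add0r, addNr, subrK, oppr_eq0, oner_eq0).
Qed.

Lemma minor_separates (y z : cell) : y != z -> diagonal y = diagonal z ->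
  exists2 v : {ffun cell -> F},
    (forall l, \sum_(x in line l) v x = 0) & v y - v z != 0.
Proof.
case: y z => [a b] [a' b'] yz; rewrite /diagonal /= => ab.
have aa' : a' != a.
  apply: contraNneq yz => eqa; rewrite (_ : b = b') ?eqa //.
  by apply: (@subrI _ a); rewrite ab eqa.
have bb' : b' != b.
  apply: contraNneq yz => eqb; rewrite (_ : a = a') ?eqb //.
  by apply: (@subIr _ b); rewrite ab eqb.
(* A third column, which exists since [m] is at least 3, gives a minor with value 1 at the first
   cell and 0 at the second. *)
have [c] : exists c, c \notin [set b; b'].
  by apply: exists_notin; rewrite card_ord cards2; case: (_ != _).
rewrite !inE negb_or => /andP[cb cb'].
exists (cell_minor a a' b c); first exact: sum_line_minor.
rewrite !ffunE !xpair_eqE !eqxx /= (eq_sym b c) (eq_sym b' c) (eq_sym a a').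
rewrite (negPf aa') (negPf bb') (negPf cb) (negPf cb') /=.
by rewrite !subr0 !addr0 subr0 oner_neq0.
Qed.

(** All requirements other than vanishing on the lines of [J] are that finitely many functionals be
    nonzero. By [infinite_field_avoid] each needs only its own test vector: a minor for two cells of
    a leg, the hypothesis for a line outside [J], and an odd minor for a set that is not a line. *)
Lemma exists_weights (J : {set direction}) :
    infinite_field F ->
    (forall k, k \notin J ->
      exists2 v : {ffun cell -> F}, (forall l, l \in J -> \sum_(x in line l) v x = 0)
        & \sum_(x in line k) v x != 0) ->
  exists w : cell -> F,
    [/\ forall y z, diagonal y = diagonal z -> w y = w z -> y = z,
        forall k, (\sum_(y in line k) w y == 0) = (k \in J)
      & forall T, #|T| = m -> (forall k, T != line k) ->
          \sum_(y in T) w y != 0].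
Proof.
move=> infF JF; pose I : finType := ({set cell} + cell * cell)%type.
pose f (i : I) v : F :=
  match i with inl T => \sum_(y in T) v y | inr p => v p.1 - v p.2 end.
pose good (i : I) : bool :=
  match i with
  | inl T => (#|T| == m) && [forall k in J, T != line k]
  | inr p => (p.1 != p.2) && (diagonal p.1 == diagonal p.2)
  end.
pose W v := forall l, l \in J -> \sum_(x in line l) v x = 0.
have sumD (u v : {ffun cell -> F^o}) (c : F) T : \sum_(x in T) (u + c *: v) x =
    \sum_(x in T) u x + c * \sum_(x in T) v x.
  by rewrite mulr_sumr -big_split; apply: eq_bigr => x _; rewrite !ffunE.
have [|u v c Wu Wv l lJ|i u v c|i|w Ww wf] := @infinite_field_avoid F
    {ffun cell -> F^o} W I f [seq i <- enum I | good i] infF.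
- by move=> l _; rewrite big1 // => x _; rewrite ffunE.
- by rewrite sumD Wu // Wv // mulr0 addr0.
- case: i => [T|[y z]] /=; first exact: sumD.
  by rewrite !ffunE mulrBr opprD addrACA.
- rewrite mem_filter => /andP[+ _]; case: i => [T|[y z]] /=; last first.
    case/andP=> yz /eqP eqd; have [v v0 vyz] := minor_separates yz eqd.
    by exists v.
  case/andP=> /eqP Tm /forall_inP TJ.
  have [/existsP[k /eqP Tk]|nl] := boolP [exists k, T == line k].
    have [|v vJ vk] := JF k; last by exists v; rewrite ?Tk.
    by apply: contraL (introT eqP Tk) => /TJ.
  have [/existsP[a /existsP[a' /existsP[b /existsP[b' odd]]]]|even] := boolP
      [exists a, exists a', exists b, exists b',
        ((a, b) \in T) (+) ((a, b') \in T) (+) ((a', b) \in T)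
          (+) ((a', b') \in T)].
    exists (cell_minor a a' b b'); last exact: sum_minor_odd.
    by move=> l _; apply: sum_line_minor.
  have [|k Tk] := even_minors_line Tm; last first.
    by case/existsP: nl; exists k; rewrite Tk.
  move=> a a' b b'; apply: contra even => odd.
  by apply/existsP; exists a; apply/existsP; exists a'; apply/existsP; exists b;
    apply/existsP; exists b'.
have {}wf i : good i -> f i w != 0.
  by move=> gi; apply: wf; rewrite mem_filter gi mem_enum.
exists w; split=> [y z eqd wyz|k|T Tm nl].
- apply/eqP; apply: contraT => yz.
  by have := wf (inr (y, z)); rewrite /= yz eqd eqxx wyz subrr eqxx => /(_ isT).
- have [kJ|kJ] := boolP (k \in J); first by rewrite Ww ?eqxx.
  apply/negbTE/(wf (inl (line k))); rewrite /= card_line eqxx.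
  apply/forall_inP => l lJ; apply: contraNneq kJ => eqkl.
  suff -> : k = l by [].
  by apply: circuit_inj; rewrite /circuit eqkl.
- apply: (wf (inl T)); rewrite /= Tm eqxx; apply/forall_inP => l _.
  exact: nl.
Qed.

(** For a row and a column, take the cell where they cross. For two parallel lines, take the
    difference of two cells on a common transverse line, where the contributions cancel. *)
Lemma two_lines_weight i j : i != j ->
  exists v : {ffun cell -> F},
  [/\ forall l, l != i -> l != j -> \sum_(x in line l) v x = 0,
    \sum_(x in line i) v x != 0 & \sum_(x in line j) v x != 0].
Proof.
have N1 : (-1 : F) != 0 by rewrite oppr_eq0 oner_neq0.
have sumB c d T : \sum_(x in T) (cell_delta c - cell_delta d) x =
    (c \in T)%:R - (d \in T)%:R.
  by rewrite -!sum_cell_delta -sumrB; apply: eq_bigr => x _; rewrite !ffunE.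
case: i j => [a|b] [a'|b'] ij.
- have aa' : a != a' by apply: contraNneq ij => ->.
  exists (cell_delta (a, ord0) - cell_delta (a', ord0)).
  split=> [[x|y] li lj||]; rewrite sumB !inE /= ?eqxx ?subrr //.
  + have -> : (a == x) = false by apply: contraNF li => /eqP->.
    have -> : (a' == x) = false by apply: contraNF lj => /eqP->.
    by rewrite subrr.
  + by rewrite (eq_sym a') (negPf aa') subr0 oner_neq0.
  + by rewrite (negPf aa') sub0r.
- exists (cell_delta (a, b')).
  split=> [[x|y] li lj||]; rewrite sum_cell_delta !inE /= ?eqxx ?oner_neq0 //.
  + suff -> : (a == x) = false by [].
    by apply: contraNF li => /eqP->.
  + suff -> : (b' == y) = false by [].
    by apply: contraNF lj => /eqP->.
- exists (cell_delta (a', b)).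
  split=> [[x|y] li lj||]; rewrite sum_cell_delta !inE /= ?eqxx ?oner_neq0 //.
  + suff -> : (a' == x) = false by [].
    by apply: contraNF lj => /eqP->.
  + suff -> : (b == y) = false by [].
    by apply: contraNF li => /eqP->.
- have bb' : b != b' by apply: contraNneq ij => ->.
  exists (cell_delta (ord0, b) - cell_delta (ord0, b')).
  split=> [[x|y] li lj||]; rewrite sumB !inE /= ?eqxx ?subrr //.
  + have -> : (b == y) = false by apply: contraNF li => /eqP->.
    have -> : (b' == y) = false by apply: contraNF lj => /eqP->.
    by rewrite subrr.
  + by rewrite (eq_sym b') (negPf bb') subr0 oner_neq0.
  + by rewrite (negPf bb') sub0r.
Qed.

End Weights.

Lemma grid_representable_all (F : fieldType) :
  infinite_field F -> representable F (Structure (grid_rank setT)).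
Proof.
move=> infF; have [|w [w_inj wJ wT]] := @exists_weights F setT infF.
  by move=> k; rewrite inE.
exact: grid_representable w_inj wJ wT.
Qed.

Lemma grid_representable_but2 (F : fieldType) (i j : direction) : i != j ->
  infinite_field F -> representable F (Structure (grid_rank (~: [set i; j]))).
Proof.
move=> ij infF; have [|w [w_inj wJ wT]] := @exists_weights F (~: [set i; j]) infF.
  move=> k; rewrite !inE negbK => kij.
  have [v [v0 vi vj]] := two_lines_weight F ij.
  exists v; first by move=> l; rewrite !inE negb_or => /andP[]; apply: v0.
  by case/orP: kij => /eqP->.
exact: grid_representable w_inj wJ wT.
Qed.

(** * Why relaxing exactly one line destroys representability *)

Lemma sum_rows_cols (F : fieldType) (w : cell -> F) :
  \sum_a \sum_(y in line (inl a)) w y = \sum_b \sum_(y in line (inr b)) w y.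
Proof.
transitivity (\sum_y w y).
  rewrite [RHS](partition_big fst predT) //=; apply: eq_bigr => a _.
  by apply: eq_bigl => y; rewrite inE.
rewrite [LHS](partition_big snd predT) //=; apply: eq_bigr => b _.
by apply: eq_bigl => y; rewrite inE.
Qed.

Lemma line_sum_forced (F : fieldType) (w : cell -> F) j :
    (forall l, l != j -> \sum_(y in line l) w y = 0) ->
  \sum_(y in line j) w y = 0.
Proof.
have := sum_rows_cols w; case: j => c tot w0.
  move: tot; rewrite [LHS](bigD1 c) //= [X in _ + X = _]big1 ?addr0 => [->|a ac];
    last exact: w0.
  by apply: big1 => b _; apply: w0.
move: tot; rewrite [RHS](bigD1 c) //= [X in _ = _ + X]big1 ?addr0 => [<-|a ac];
  last exact: w0.
by apply: big1 => b _; apply: w0.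
Qed.

Lemma grid_rank_tip (J : {set direction}) (X : {set option cell}) :
  None \in X -> grid_rank J X = minn m #|legs diagonal X|.+1.
Proof.
rewrite /grid_rank; case: ifP => // /card_legs_eq [nX _] tX.
by rewrite tX in nX.
Qed.

Lemma card_legs_sub_circuit k (X : {set option cell}) : X \subset circuit k ->
  #|legs diagonal X| = #|X|.
Proof.
move/subsetP=> sX; have cX : {subset cells X <= line k}.
  by move=> c cX; rewrite -cells_circuit inE; apply: sX; rewrite inE in cX.
rewrite card_in_imset; last by move=> c d /cX ck /cX dk; apply: diagonal_line_inj ck dk.
rewrite card_cells (_ : None \in X = false) //.
by apply/negbTE/negP => /sX/imsetP[].
Qed.

Lemma grid_rank_circuit (J : {set direction}) l :
  grid_rank J (circuit l) = (m - (l \in J))%N.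
Proof.
rewrite /grid_rank (card_legs_sub_circuit (subxx _)) eqxx card_circuit.
by rewrite mem_imset //; apply: circuit_inj.
Qed.

Lemma grid_rank_sub_circuit (J : {set direction}) l (X : {set option cell}) :
  X \proper circuit l -> grid_rank J X = #|X|.
Proof.
move=> /[dup] /proper_card Xm /proper_sub Xl.
rewrite /grid_rank (card_legs_sub_circuit Xl) eqxx.
suff -> : (X \in circuit @: J) = false by rewrite subn0.
apply/negbTE/negP => /imsetP[l' _ eqX].
by rewrite eqX !card_circuit ltnn in Xm.
Qed.

Section NotRepresentable.
Variables (F : fieldType) (V : vectType F) (phi : option cell -> V).
Variable J : {set direction}.
Hypothesis phi_rank : forall X, fam_dim phi X = grid_rank J X.

(** The circuit is dependent while its proper subsets are independent, so no coefficient of a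
    nontrivial relation can vanish. *)
Lemma circuit_relation k : k \in J ->
  exists2 c : option cell -> F, \sum_(x in circuit k) c x *: phi x = 0 &
    {in circuit k, forall x, c x != 0}.
Proof.
move=> kJ.
have dep : fam_dim phi (circuit k) <> #|circuit k|.
  by rewrite phi_rank grid_rank_circuit kJ card_circuit; lia.
have [c rel [x0 x0k cx0]] : exists2 c : option cell -> F,
    \sum_(x in circuit k) c x *: phi x = 0 &
    exists2 x, x \in circuit k & c x != 0.
  apply: boolp.contrapT => no; apply/dep/fam_freeP => c rel x xk.
  by apply/eqP/negPn/negP => cx; apply: no; exists c => //; exists x.
exists c => // x xk; apply/eqP => cx.
have /fam_freeP/(_ c) free_x : fam_dim phi (circuit k :\ x) = #|circuit k :\ x|.
  by rewrite phi_rank (@grid_rank_sub_circuit _ k) ?properD1.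
have xx0 : x0 != x by apply: contraNneq cx0 => ->; rewrite cx.
case/eqP: cx0; apply: free_x; last by rewrite !inE xx0.
by rewrite -[RHS]rel [RHS](big_setD1 x) //= cx scale0r add0r.
Qed.

Lemma sum_circuit (f : option cell -> V) k :
  \sum_(x in circuit k) f x = \sum_i f (Some (line_point k i)).
Proof.
rewrite big_imset /=; last by move=> ? ? _ _ [].
rewrite lineE big_imset /=; last by move=> i i' _ _; apply: line_point_inj.
by apply: eq_bigl => i; rewrite inE.
Qed.

(** Rescaling the vectors of one circuit by its relation recovers the frame of the spike
    construction. Together with the tip, any [n.+2] of them are independent, so [e_sum] spans all
    relations. *)
Lemma circuit_frame k : k \in J ->
  exists2 c : 'I_m -> F, (forall i, c i != 0) &
    let e i := c i *: phi (Some (line_point k i)) in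
    \sum_i e i = 0 /\
    forall (b : 'I_m -> F) d, \sum_i b i *: e i + d *: phi None = 0 ->
      d = 0 /\ forall i j, b i = b j.
Proof.
case/circuit_relation => c rel c0.
exists (fun i => c (Some (line_point k i))) => [i|].
  by apply/c0/imset_f; rewrite lineE imset_f.
move=> e; have e_sum : \sum_i e i = 0 by rewrite -[RHS]rel sum_circuit.
split=> // b d relb.
have main i0 : d = 0 /\ forall i, b i = b i0.
  pose x0 := Some (line_point k i0).
  have x0k : x0 \in circuit k by apply/imset_f; rewrite lineE imset_f.
  pose S := None |: circuit k :\ x0.
  have NS : None \notin circuit k :\ x0.
    by rewrite !inE; apply/nandP; right; apply/imsetP => -[].
  have cS : #|circuit k :\ x0| = n.+2.
    by have := cardsD1 x0 (circuit k); rewrite x0k card_circuit => -[].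
  have /fam_freeP free_S : fam_dim phi S = #|S|.
    rewrite cardsU1 NS cS phi_rank grid_rank_tip ?setU11 //.
    have -> : legs diagonal S = legs diagonal (circuit k :\ x0).
      rewrite /legs (_ : cells S = cells (circuit k :\ x0)) //.
      by apply/setP => y; rewrite !inE.
    by rewrite (@card_legs_sub_circuit k) ?subsetDl // cS minnn.
  (* Subtracting [b i0] times [e_sum] removes [x0] and leaves a relation on the independent set
     [S]. *)
  pose g x := if x is Some y then (b (diagonal y) - b i0) * c x else d.
  have relg : \sum_(x in S) g x *: phi x = 0.
    rewrite big_setU1 //=.
    have -> : \sum_(x in circuit k :\ x0) g x *: phi x =
        \sum_(x in circuit k) g x *: phi x.
      rewrite [RHS](big_setD1 x0) //= diagonal_line_point subrr mul0r scale0r.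
      by rewrite add0r.
    rewrite sum_circuit addrC -[RHS]relb; congr (_ + _).
    have e0 : b i0 *: \sum_i e i = 0 by rewrite e_sum scaler0.
    rewrite -[RHS]subr0 -[X in _ - X]e0 scaler_sumr -sumrB.
    apply: eq_bigr => i _.
    by rewrite /g diagonal_line_point -scalerA -scalerBl.
  split=> [|i]; first by have := free_S g relg None; rewrite setU11 => /(_ isT).
  have [->//|ii] := eqVneq i i0.
  have iS : Some (line_point k i) \in S.
    rewrite !inE /=; apply/andP; split; last by apply: imset_f; rewrite lineE imset_f.
    by apply: contra_neq ii => -[] /line_point_inj.
  have := free_S g relg _ iS; rewrite /g diagonal_line_point => /eqP.
  rewrite mulf_eq0 subr_eq0 (negPf (c0 _ _)) ?orbF => [/eqP//|].
  by apply/imset_f; rewrite lineE imset_f.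
by split=> [|i j]; [case: (main ord0)|case: (main j)].
Qed.

(** Two cells of a leg and the tip have rank 2, as has the tip with either cell. If [a] were zero,
    [phi (Some y)] would be parallel to the tip. *)
Lemma tip_span (y z : cell) : diagonal y = diagonal z ->
  exists a b, a != 0 /\ phi (Some y) = a *: phi (Some z) + b *: phi None.
Proof.
move=> yz; pose S2 (u : cell) : {set option cell} := [set None; Some u].
have rk2 u : fam_dim phi (S2 u) = 2%N.
  rewrite phi_rank grid_rank_tip ?set21 //.
  have -> : legs diagonal (S2 u) = [set diagonal u].
    rewrite /legs (_ : cells (S2 u) = [set u]) ?imset_set1 //.
    by apply/setP => v; rewrite !inE.
  by rewrite cards1.
have rk3 : fam_dim phi (Some y |: S2 z) = 2%N.
  rewrite phi_rank grid_rank_tip; last by rewrite setU1r ?set21.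
  have -> : legs diagonal (Some y |: S2 z) = [set diagonal z].
    rewrite /legs (_ : cells _ = [set y; z]).
      by rewrite imsetU !imset_set1 yz setUid.
    by apply/setP => v; rewrite !inE.
  by rewrite cards1.
have : phi (Some y) \in <<[seq phi x | x in S2 z]>>%VS.
  have /eqP -> : <<[seq phi x | x in S2 z]>>%VS ==
      <<[seq phi x | x in Some y |: S2 z]>>%VS.
    by rewrite eqEdim fam_span_sub ?subsetUr // -!/(fam_dim _ _) rk2 rk3.
  by apply: fam_span_mem; rewrite setU11.
have sub : (<<[seq phi x | x in S2 z]>> <= <[phi (Some z)]> + <[phi None]>)%VS.
  apply/span_subvP => _ /imageP[x xS ->].
  case/set2P: xS => ->; first by rewrite -[X in X \in _]add0r memv_add ?mem0v ?memv_line.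
  by rewrite -[X in X \in _]addr0 memv_add ?mem0v ?memv_line.
move/(subvP sub)/memv_addP => [_ /vlineP[a ->] [_ /vlineP[b ->] yE]].
exists a, b; split=> //; apply/eqP => a0.
have : (<<[seq phi x | x in S2 y]>> <= <[phi None]>)%VS.
  apply/span_subvP => _ /imageP[x xS ->].
  case/set2P: xS => ->; first exact: memv_line.
  by rewrite yE a0 scale0r add0r memvZ ?memv_line.
move/dimvS; rewrite -/(fam_dim _ _) rk2 dim_vline.
by case: (_ != _).
Qed.

(** A single line of [J] supplies a frame in which every cell takes the form of [spike_vec].
    Comparing [fam_dim_untipped] with [grid_rank] on each circuit then shows which line weights
    vanish. *)
Lemma representation_weights k : k \in J ->
  exists w : cell -> F, forall l, (\sum_(y in line l) w y == 0) = (l \in J).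
Proof.
case/circuit_frame => c c0.
set e := (e in let e := e in _) => -[e_sum e_free].
have cellP y : exists aw : F * F, aw.1 != 0 /\
    phi (Some y) = aw.1 *: (e (diagonal y) + aw.2 *: phi None).
  have [|a [b [a0 yE]]] := @tip_span y (line_point k (diagonal y)).
    by rewrite diagonal_line_point.
  pose d := c (diagonal y); have d0 : d != 0 by apply: c0.
  exists (a / d, b * d / a); split=> /=; first by rewrite mulf_neq0 ?invr_neq0.
  rewrite yE scalerDr !scalerA; congr (_ *: _ + _ *: _).
    by rewrite divfK.
  by field; rewrite a0 d0.
have [aw awE] := fin_all_exists cellP.
exists (fun y => (aw y).2) => l.
have := fam_dim_untipped (ltn0Sn _) e_sum e_free (a := fun y => (aw y).1)
  (fun y => (aw y).2) (fun y => (awE y).1) (leg := diagonal) (X := circuit l).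
rewrite (card_legs_sub_circuit (subxx _)) cells_circuit card_circuit !eqxx.
move=> /(_ isT); have -> : fam_dim (spike_vec diagonal e (phi None)
    (fun y => (aw y).1) (fun y => (aw y).2)) (circuit l) = fam_dim phi (circuit l).
  congr (\dim <<_>>); apply: eq_map => -[y|] //=.
  by rewrite (awE y).2.
rewrite phi_rank grid_rank_circuit /=.
by case: (_ == 0) (l \in J) => -[] //; lia.
Qed.

End NotRepresentable.

Lemma grid_not_representable (F : fieldType) j :
  ~ representable F (Structure (grid_rank (~: [set j]))).
Proof.
case=> V [phi phi_rank].
have [k kj] : exists k, k != j.
  by case: j {phi_rank phi} => x; [exists (inr x)|exists (inl x)].
have [||w wJ] := @representation_weights F V phi (~: [set j]) _ k.
- by move=> X; rewrite -[RHS]/(rk (s := Structure (grid_rank (~: [set j]))) X) phi_rank.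
- by rewrite !inE.
have : \sum_(y in line j) w y = 0.
  by apply: line_sum_forced => l lj; apply/eqP; rewrite wJ !inE.
by move/eqP; rewrite wJ !inE eqxx.
Qed.

End Grid.

Lemma representable_matroid (F : fieldType) (M : structure) :
  representable F M -> is_matroid M.
Proof.
case=> V [phi phi_rank]; split=> [X|X Y XY|X Y]; rewrite !phi_rank.
- exact: fam_dim_card.
- exact: fam_dim_sub.
- exact: fam_dim_submod.
Qed.

Lemma rank_axioms_M_logic f : List.In f [:: R1; R2; R3] ->
  sentence f /\ M_logic f.
Proof.
have forall_M Xs P : quantifier_free P ->
    M_logic (foldr (quantify_set QForall) P Xs).
  move=> qfP; exists (foldr (quantify_set QForall) P Xs) => //.
  by exists QForall, QForall, Xs, [::], P.
by case=> [<-|[<-|[<-|//]]]; split=> //;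
  [apply: (forall_M [:: 1%N])|apply: (forall_M [:: 1%N; 2%N])
  |apply: (forall_M [:: 1%N; 2%N])].
Qed.

Local Close Scope ring_scope.

Theorem theorem1p3 (Fs : fieldType -> Prop)
    (hFs : exists2 F : fieldType, Fs F & infinite_field F) :
  ~ exists K : seq formula,
      (forall f : formula, List.In f K -> sentence f /\ M_logic f) /\
      (forall M : structure,
         is_matroid M /\ representable_over_some Fs M <->
         [/\ models M R1, models M R2, models M R3
           & forall f : formula, List.In f K -> models M f]).
Proof.
case=> K [K_M K_iff]; case: hFs => F FsF infF.
(* The rank axioms are themselves in M-logic. Transferring them along with [K] gives them for the
   one-line relaxation too. *)
pose K' := [:: R1; R2; R3] ++ K.
have K'_M f : List.In f K' -> sentence f /\ M_logic f.
  by move=> /(List.in_app_or [:: R1; R2; R3] K) [/rank_axioms_M_logic|/K_M].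
have rep_models M f : representable F M -> List.In f K' -> models M f.
  move=> repM; have [|m1 m2 m3 mK] := (K_iff M).1.
    by split; [apply: representable_matroid repM|exists F].
  by move=> /(List.in_app_or [:: R1; R2; R3] K) [|/mK//] [<-|[<-|[<-|]]].
have [C [L transfer]] := M_logic_transfers_seq K'_M.
(* Distinct circuits are at distance at least [n.+2], which exceeds [2 * L], and there are
   [2 * n.+3] lines, more than [C.+1]. *)
pose n := (C + 2 * L)%N.
have [||||f fK|i j f ij fK|bad bad_le bad_models] :=
  transfer (option ('I_n.+3 * 'I_n.+3)%type) None _ (@circuit n) (grid_rank setT)
  (fun j => grid_rank (~: [set j]))
  (fun i j => grid_rank (~: [set i; j])).
- move=> i j /card_symdiff_circuit; apply: leq_trans.
  by rewrite /n ltnS; lia.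
- by rewrite card_sum card_ord /n; lia.
- move=> j X; apply: grid_rank_off; apply/setP => l.
  by rewrite !inE andbT andbb.
- move=> i j X ij; apply: grid_rank_off; apply/setP => l.
  by rewrite !inE negb_or; case: (l == i).
- by apply: rep_models fK; apply: grid_representable_all.
- by apply: rep_models fK; apply: grid_representable_but2.
have [|j jbad] := @exists_notin _ bad.
  by apply: leq_ltn_trans bad_le _; rewrite card_sum card_ord /n; lia.
have models_j f := fun fK => bad_models j f jbad fK.
have [_ [G _ repG]] : is_matroid (Structure (grid_rank (~: [set j]))) /\
    representable_over_some Fs (Structure (grid_rank (~: [set j]))).
  apply/K_iff; split; try by apply: models_j; rewrite /K' /=; tauto.
  by move=> f fK; apply: models_j; do 3 right.
exact: grid_not_representable repG.
Qed.
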